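(* Let $F$ be a free group of any infinite cardinality (regarded as a discrete group). Then there exists a weight $w:F\to(0,\infty)$ such that for every $p$ with $1<p\leqslant 2$ the weighted space $\mathcal{L}_p^w(F)$ is a Banach algebra with respect to convolution.
   Context: For a discrete group $F$ (with counting measure), a weight is a function $w:F\to(0,\infty)$, and for $1\leqslant p<\infty$ $$\mathcal{L}_p^w(F)=\Big\{f:F\to\mathbb{C}\ :\ \sum_{x\in F}|f(x)w(x)|^p<\infty\Big\},\qquad \|f\|_{p,w}=\Big(\sum_{x\in F}|f(x)w(x)|^p\Big)^{1/p}.$$ Convolution is $(f*g)(\alpha)=\sum_{\beta\in F}f(\beta)g(\beta^{-1}\alpha)$. That $\mathcal{L}_p^w(F)$ is a Banach algebra with respect to convolution means that for all $f,g\in\mathcal{L}_p^w(F)$ the convolution $f*g$ is defined (the sums converge absolutely), belongs to $\mathcal{L}_p^w(F)$, and $\|f*g\|_{p,w}\leqslant\|f\|_{p,w}\|g\|_{p,w}$ (no unit of norm one is required). *)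

(* Defs.v *)
From mathcomp Require Import all_boot all_order all_algebra finmap.
From mathcomp Require Import complex.
From mathcomp Require Import all_classical all_reals all_analysis.
From mathcomp.analysis.showcase Require summability.
Set Implicit Arguments.
Unset Strict Implicit.
Unset Printing Implicit Defensive.
Import Order.TTheory GRing.Theory Num.Theory.
Import numFieldNormedType.Exports.
Import ComplexField.Normc.

Local Open Scope classical_set_scope.
Local Open Scope complex_scope.
Local Open Scope ring_scope.

(* Universal property: every map from X to a group G extends uniquely to a
   group morphism F -> G (multiplicative maps between groups preserve 1). *)
Definition free_basis (F : groupType) (X : set F) : Prop :=
  forall (G : groupType) (f : X -> G),
    exists phi : {multiplicative F -> G},
      (forall x : X, phi (val x) = f x) /\
      (forall psi : {multiplicative F -> G},
         (forall x : X, psi (val x) = f x) -> psi =1 phi).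

Definition free_group (F : groupType) : Prop :=
  exists X : set F, free_basis X.

Section WeightedSpaces.
Variables (R : realType) (F : groupType).
Implicit Types (p : R) (w : F -> R) (f g : F -> R[i]).

(* The summands are nonnegative, so \esum is the supremum of the finite
   partial sums; F may be uncountable. *)
Definition wsum p w f : \bar R :=
  (\esum_(x in [set: F]) ((normc (f x * (w x)%:C) `^ p)%:E))%E.

Definition weighted_Lp p w : set (F -> R[i]) :=
  [set f | (wsum p w f < +oo)%E].

Definition wnorm p w f : \bar R := (wsum p w f `^ p^-1)%E.

Definition convolution_term f g (a : F) : F -> R[i] :=
  fun b => f b * g (b^-1 * a)%g.

Definition convolution_defined f g : Prop :=
  forall a, summable [set: F] (fun b => (normc (convolution_term f g a b))%:E).

(* summability.sum is the limit of the partial sums along the directed family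
   of finite subsets of F; R[i] carries its norm topology through R[i]^o. *)
Definition convolution f g : F -> R[i] :=
  fun a => summability.sum (convolution_term f g a : F -> R[i]^o).

Definition Lp_banach_algebra p w : Prop :=
  forall f g, weighted_Lp p w f -> weighted_Lp p w g ->
    [/\ convolution_defined f g,
        weighted_Lp p w (convolution f g) &
        (wnorm p w (convolution f g) <= wnorm p w f * wnorm p w g)%E].

End WeightedSpaces.

(* Main.v *)
Require Import Defs.
From HB Require Import structures.
From mathcomp Require Import all_boot all_order all_algebra.
From mathcomp Require Import finmap complex.
From mathcomp Require Import all_classical all_reals all_analysis.
From mathcomp.analysis.showcase Require summability.
From mathcomp Require Import ring lra zify.
Import Order.TTheory GRing.Theory Num.Theory.
Import numFieldNormedType.Exports.
Import ComplexField.Normc.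
Set Implicit Arguments.
Unset Strict Implicit.
Unset Printing Implicit Defensive.

Local Open Scope classical_set_scope.
Local Open Scope ring_scope.

(** Let |a| be the reduced word length of a in F. The weight is
    w(a) = 128 (1 + |a|)^4, the same for every p.

    In a product a = b c of reduced words, some suffix e of b cancels against
    the prefix e^-1 of c: b = x e, c = e^-1 y, a = x y without further
    cancellation ([reduced_cancellation]). Sort the pairs (a, b) by |e| and by
    the length of the shorter of x and y. In one class, a and the sorting data
    determine x and y, b determines x, and c determines y. This is the only
    combinatorial fact that is used, and it is called [rectangular] below:
    a is determined by (b, c) even if b and c come from two different
    factorizations of a in that class. For u, v >= 0 and 1 < p <= 2, Hoelder's
    inequality and the inclusion of l_p in l_q (q conjugate to p, hence q >= p)
    give

      (sum_b u(b) v(b^-1 a))^p <= (sum_b u(b)^p) (sum_b v(b^-1 a)^p),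

    b running over the factorizations of a in the class. On summing over a, the
    right-hand side becomes a sum of u(b)^p v(c)^p over pairs (b, c) that occur
    at most once, so the convolution restricted to one class maps l_p x l_p
    to l_p with norm at most 1 ([rectangular_convolution_le]). This is the
    l_p form of Haagerup's inequality.

    The classes are indexed by a countable set, and w(a) <= c_i w(b) w(c) on
    the class i, where sum_i c_i <= 1 ([overlap_cover],
    [esum_overlap_weight]): polynomial growth of w turns into decay
    in the shorter of the two factors. Jensen's inequality for the weights c_i
    sums the classes up ([Lp_banach_algebra_of_cover]).

    Freeness is the universal property of a basis, and word length makes sense
    because this property gives every element exactly one reduced word. This is
    van der Waerden's argument: F acts on reduced words, because the generators
    do ([free_basis_normal_form]). *)

(** * Reduced words and cancellation *)

Section ReducedWords.
Variable X : eqType.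
Implicit Types (l m : X * bool) (s t : seq (X * bool)).

Definition letter_inv l : X * bool := (l.1, ~~ l.2).

Definition word_inv s := rev (map letter_inv s).

Definition reduced s := sorted (fun l m => m != letter_inv l) s.

Definition reduced_cons l s :=
  if s is m :: s' then if m == letter_inv l then s' else l :: s else [:: l].

Lemma letter_invK : involutive letter_inv.
Proof. by case=> x b; rewrite /letter_inv /= negbK. Qed.

Lemma word_inv_rcons s l : word_inv (rcons s l) = letter_inv l :: word_inv s.
Proof. by rewrite /word_inv map_rcons rev_rcons. Qed.

Lemma size_word_inv s : size (word_inv s) = size s.
Proof. by rewrite size_rev size_map. Qed.

Lemma reduced_consP l s :
  reduced (l :: s) = (if s is m :: _ then m != letter_inv l else true) && reduced s.
Proof. by case: s. Qed.

Lemma reduced_cons_reduced l s : reduced s -> reduced (reduced_cons l s).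
Proof.
case: s => [|m s]//= rs; case: ifPn => [_|ml]; last by rewrite /= ml.
by case: s rs => //= k s /andP[].
Qed.

Lemma reduced_consE l s : reduced (l :: s) -> reduced_cons l s = l :: s.
Proof. by case: s => //= m s /andP[/negPf->]. Qed.

Lemma reduced_consK l s :
  reduced s -> reduced_cons (letter_inv l) (reduced_cons l s) = s.
Proof.
case: s => [_|m s rs] /=; first by rewrite letter_invK eqxx.
case: (eqVneq m (letter_inv l)) rs => [->|ml] rs; last by rewrite /= letter_invK eqxx.
by rewrite reduced_consE.
Qed.

(** Cancellation between two reduced words eats letters from the end of the
    first one and the beginning of the second one; it stops at the first pair
    of letters that are not inverse to each other, and that pair keeps the
    remaining concatenation reduced. *)
Lemma reduced_cancellation s t : reduced s -> reduced t ->
  exists x e y, [/\ s = x ++ e, t = word_inv e ++ y & reduced (x ++ y)].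
Proof.
elim/last_ind: s t => [|s l IH] t rs rt; first by exists [::], [::], t.
have rs' : reduced s by move: rs; rewrite /reduced -cats1 => /cat_sorted2[].
case: t rt => [|m t] rt.
  by exists (rcons s l), [::], [::]; rewrite !cats0.
have [ml|ml] := eqVneq m (letter_inv l); last first.
  exists (rcons s l), [::], (m :: t); rewrite cats0; split => //.
  move: rs; rewrite /reduced; case: (s) rt => [|k s''] rt /=; first by rewrite ml.
  by rewrite cat_path => ->; rewrite last_rcons /= ml.
have [|x [e [y [-> te rxy]]]] := IH t rs' _.
  by move: rt; rewrite reduced_consP => /andP[].
exists x, (rcons e l), y; split => //; first by rewrite rcons_cat.
by rewrite word_inv_rcons ml te.
Qed.

End ReducedWords.

(** * The normal form in a free group *)

Section WordAction.
Variables (F : groupType) (X : set F).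
Notation word := (seq (X * bool)).
Implicit Types (s : word) (l : X * bool).

Definition letter_val l : F := if l.2 then val l.1 else (val l.1)^-1%g.

Definition word_val s : F := foldr (fun l g => (letter_val l * g)%g) 1%g s.

Lemma letter_val_inv l : letter_val (letter_inv l) = (letter_val l)^-1%g.
Proof. by case: l => x [] //=; rewrite /letter_val /= invgK. Qed.

Lemma word_val_cat s t : word_val (s ++ t) = (word_val s * word_val t)%g.
Proof. by elim: s => [|l s IH] /=; rewrite ?mul1g // IH mulgA. Qed.

Lemma word_val_inv s : word_val (word_inv s) = (word_val s)^-1%g.
Proof.
elim/last_ind: s => [|s l IH]; first by rewrite invg1.
by rewrite word_inv_rcons -cats1 word_val_cat /= mulg1 invgM IH letter_val_inv.
Qed.

Lemma word_val_reduced_cons l s :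
  word_val (reduced_cons l s) = (letter_val l * word_val s)%g.
Proof.
case: s => [//|m s] /=; case: eqP => [->|_] //=.
by rewrite letter_val_inv mulVKg.
Qed.

(** A bijection of words that preserves reducedness and that lifts the left
    translation by an element of F. Carrying this element along turns the
    universal property into the fact that the action of g on words lifts the
    translation by g itself. The two maps are defined on all words, so
    that bijections can be compared without a subtype of reduced words. *)
Record translation := Translation {
  translation_elt : F;
  translation_fun : word -> word;
  translation_inv : word -> word;
  translation_reduced : forall s, reduced s -> reduced (translation_fun s);
  translation_inv_reduced : forall s, reduced s -> reduced (translation_inv s);
  translation_funK : cancel translation_fun translation_inv;
  translation_invK : cancel translation_inv translation_fun;
  translation_val : forall s, reduced s ->
    word_val (translation_fun s) = (translation_elt * word_val s)%g }.

Lemma translation_eq (a b : translation) :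
  translation_elt a = translation_elt b ->
  translation_fun a = translation_fun b ->
  translation_inv a = translation_inv b -> a = b.
Proof.
case: a b => [g f h a1 a2 a3 a4 a5] [g' f' h' b1 b2 b3 b4 b5] /= eg ef eh.
by subst; congr Translation; exact: Prop_irrelevance.
Qed.

HB.instance Definition _ := gen_eqMixin translation.
HB.instance Definition _ := gen_choiceMixin translation.

Definition translation1 : translation.
Proof. by refine (@Translation 1%g id id _ _ _ _ _) => // s _; rewrite mul1g. Defined.

Definition translationV (a : translation) : translation.
Proof.
refine (@Translation (translation_elt a)^-1%g (translation_inv a) (translation_fun a) _ _ _ _ _).
- exact: translation_inv_reduced.
- exact: translation_reduced.
- exact: translation_invK.
- exact: translation_funK.
- move=> s rs; rewrite -{2}(translation_invK a s) translation_val ?mulKg//.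
  exact: translation_inv_reduced.
Defined.

Definition translationM (a b : translation) : translation.
Proof.
refine (@Translation (translation_elt a * translation_elt b)%g
  (translation_fun a \o translation_fun b)
  (translation_inv b \o translation_inv a) _ _ _ _ _).
- by move=> s rs; do 2 apply: translation_reduced.
- by move=> s rs; do 2 apply: translation_inv_reduced.
- by apply: can_comp; exact: translation_funK.
- by apply: can_comp; exact: translation_invK.
- move=> s rs /=; rewrite !translation_val ?mulgA//.
  exact: translation_reduced.
Defined.

Lemma translationA : associative translationM.
Proof. by move=> a b c; apply: translation_eq => //=; rewrite mulgA. Qed.
Lemma translation1M : left_id translation1 translationM.
Proof. by move=> a; apply: translation_eq => //=; rewrite mul1g. Qed.
Lemma translationM1 : right_id translation1 translationM.
Proof. by move=> a; apply: translation_eq => //=; rewrite mulg1. Qed.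
Lemma translationVM : left_inverse translation1 translationV translationM.
Proof.
move=> a; apply: translation_eq => /=; first by rewrite mulVg.
  by apply/funext => s /=; rewrite translation_funK.
by apply/funext => s /=; rewrite translation_funK.
Qed.
Lemma translationMV : right_inverse translation1 translationV translationM.
Proof.
move=> a; apply: translation_eq => /=; first by rewrite mulgV.
  by apply/funext => s /=; rewrite translation_invK.
by apply/funext => s /=; rewrite translation_invK.
Qed.

HB.instance Definition _ := isGroup.Build translation translationA
  translation1M translationM1 translationVM translationMV.

Lemma translation_elt_mul : {morph translation_elt : a b / (a * b)%g}.
Proof. by []. Qed.
HB.instance Definition _ :=
  isMultiplicative.Build translation F translation_elt translation_elt_mul.

(** [reduced_cons] is injective on reduced words only; leaving the other words
    alone makes it a bijection. *)
Definition guarded_cons l s := if reduced s then reduced_cons l s else s.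

Lemma guarded_cons_reduced l s : reduced s -> reduced (guarded_cons l s).
Proof. by rewrite /guarded_cons => rs; rewrite rs reduced_cons_reduced. Qed.

Lemma guarded_consK l : cancel (guarded_cons l) (guarded_cons (letter_inv l)).
Proof.
move=> s; rewrite /guarded_cons; case: (boolP (reduced s)) => [rs|/negPf->//].
by rewrite reduced_cons_reduced// reduced_consK.
Qed.

Definition letter_translation l : translation.
Proof.
refine (@Translation (letter_val l) (guarded_cons l) (guarded_cons (letter_inv l)) _ _ _ _ _).
- exact: guarded_cons_reduced.
- exact: guarded_cons_reduced.
- exact: guarded_consK.
- by rewrite -{2}(letter_invK l); exact: guarded_consK.
- by move=> s rs; rewrite /guarded_cons rs word_val_reduced_cons.
Defined.

Lemma letter_translationV l :
  letter_translation (letter_inv l) = (letter_translation l)^-1%g.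
Proof. by apply: translation_eq; rewrite //= ?letter_val_inv// letter_invK. Qed.

(** The image of 1 is idempotent, hence 1: multiplicativity alone gives a group
    morphism. *)
Lemma multiplicativeV (G H : groupType) (f : {multiplicative G -> H}) g :
  f (g^-1)%g = (f g)^-1%g.
Proof.
have f1 : f 1%g = 1%g by apply: (mulgI (f 1%g)); rewrite -gmulfM !mulg1.
by apply: (mulgI (f g)); rewrite -gmulfM !mulgV.
Qed.

(** The universal property sends the basis to the translations by letters. The
    composite F -> translations -> F fixes the basis, so it is the identity by
    uniqueness: g acts on words as a lift of the translation by g. The word of g
    is the image of the empty word, and the letters of a reduced word, acting one
    after another on the empty word, rebuild that word without cancellation. *)
Theorem free_basis_normal_form : free_basis X ->
  exists nf : F -> word, [/\ forall g, reduced (nf g),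
    cancel nf word_val & forall s, reduced s -> nf (word_val s) = s].
Proof.
move=> freeX.
have [phi [phiX _]] := freeX translation (fun x => letter_translation (x, true)).
have [id_ [_ id_uniq]] := freeX F val.
have phi_elt g : translation_elt (phi g) = g.
  transitivity (id_ g); last by rewrite -(id_uniq idfun).
  by apply: (id_uniq (translation_elt \o phi)) => x /=; rewrite phiX.
have phi_letter l : phi (letter_val l) = letter_translation l.
  case: l => x []; first exact: phiX.
  by rewrite [LHS]multiplicativeV phiX -letter_translationV.
exists (fun g => translation_fun (phi g) [::]); split => [g|g|s].
- exact: translation_reduced.
- by rewrite translation_val// phi_elt /= mulg1.
- elim: s => [_|l s IH rls] /=.
    have -> : phi 1%g = 1%g by apply: (mulgI (phi 1%g)); rewrite -gmulfM !mulg1.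
    by [].
  have rs : reduced s by move: rls; rewrite reduced_consP => /andP[].
  rewrite gmulfM phi_letter [LHS]/= IH// /guarded_cons rs.
  exact: reduced_consE.
Qed.

End WordAction.

(** * Sums of nonnegative families *)

Section ExtendedSums.
Context {R : realType}.
Implicit Types (I J : choiceType).
Local Open Scope ereal_scope.

Lemma poweR_mono (p : R) (x y : \bar R) : (0 <= p)%R -> 0 <= x -> x <= y ->
  x `^ p <= y `^ p.
Proof.
move=> p0 x0 xy; apply: gt0_ler_poweR => //.
  by rewrite in_itv /= x0 leey.
by rewrite in_itv /= (le_trans x0 xy) leey.
Qed.

Lemma esum_le_inj I J (P : set I) (Q : set J) (e : I -> J) (a : J -> \bar R) :
  (forall j, Q j -> 0 <= a j) -> {homo e : i / P i >-> Q i} ->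
  {in P &, injective e} -> \esum_(i in P) a (e i) <= \esum_(j in Q) a j.
Proof.
move=> a0 ePQ einj; rewrite -esum_image//.
have -> : e @` P = Q `&` e @` P.
  by rewrite setIidr// => _ [i Pi <-]; exact: ePQ.
rewrite esum_mkcondr; apply: le_esum => j Qj; case: ifP => // _; exact: a0.
Qed.

(** The inequality <= passes to the supremum from finite sums. For a finite
    nonzero factor, the other inequality is the first one for the inverse
    factor; for +oo, a single nonzero term makes both sides infinite. *)
Lemma esumZl I (D : set I) (x : \bar R) (a : I -> \bar R) :
  0 <= x -> (forall i, D i -> 0 <= a i) ->
  \esum_(i in D) (x * a i) = x * \esum_(i in D) a i.
Proof.
move=> x0 a0.
wlog {a0} a0 : a / forall i, 0 <= a i.
  move=> H; rewrite (@eq_esum _ _ _ _ (fun i => x * (if i \in D then a i else 0))).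
    rewrite H; first by congr (_ * _); apply: eq_esum => i Di; rewrite mem_set.
    by move=> i; case: ifPn => // /set_mem; exact: a0.
  by move=> i Di; rewrite mem_set.
have easy (y : \bar R) (b : I -> \bar R) : 0 <= y -> (forall i, 0 <= b i) ->
    \esum_(i in D) (y * b i) <= y * \esum_(i in D) b i.
  move=> y0 b0; apply: ge_ereal_sup => _ [X [finX XD] <-].
  rewrite -ge0_mule_fsumr//; apply: lee_wpmul2l => //.
  by apply: ereal_sup_ubound; exists X.
apply/eqP; rewrite eq_le easy//=.
case: x x0 => [r|_|//].
- rewrite lee_fin => r_ge0.
  have [->|rN0] := eqVneq r 0%R; first by rewrite mul0e esum_ge0// => i _; rewrite mul0e.
  have r0 : (0 < r)%R by rewrite lt_neqAle eq_sym rN0.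
  rewrite -lee_pdivlMl//; apply: le_trans (easy _ _ _ _); first last.
  + by move=> i; rewrite mule_ge0// lee_fin ltW.
  + by rewrite lee_fin invr_ge0 ltW.
  apply: le_esum => i _; rewrite muleA -EFinM mulVf ?mul1e ?gt_eqF//.
- have [->|] := eqVneq (\esum_(i in D) a i) 0.
    by rewrite mule0 esum_ge0// => i _; rewrite mule_ge0.
  move=> s0; have /existsNP[i /not_implyP[Di ai]] : ~ forall i, D i -> a i = 0.
    by move=> /esum1 H; rewrite H eqxx in s0.
  have ai0 : 0 < a i by rewrite lt_neqAle a0 andbT eq_sym; apply/eqP.
  apply: le_trans (leey _) _; rewrite -[leLHS](gt0_mulye ai0).
  have ya0 j : 0 <= +oo * a j by rewrite mule_ge0.
  rewrite (esumID [set i]) => [|j _]; last exact: ya0.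
  rewrite setIidr; last by move=> _ ->.
  by rewrite esum_set1// leeDl// esum_ge0// => j _.
Qed.

Lemma esum_mul I J (P : set I) (Q : set J) (a : I -> \bar R) (b : J -> \bar R) :
  (forall i, P i -> 0 <= a i) -> (forall j, Q j -> 0 <= b j) ->
  (\esum_(i in P) a i) * (\esum_(j in Q) b j) =
  \esum_(k in P `*` Q) (a k.1 * b k.2).
Proof.
move=> a0 b0; rewrite -[P `*` Q]/(P `*`` (fun=> Q)).
rewrite -(@esum_esum _ _ _ P (fun=> Q) (fun i j => a i * b j)); last first.
  by move=> i j /a0 ai /b0 bj; rewrite mule_ge0.
rewrite muleC -esumZl//; last exact: esum_ge0.
by apply: eq_esum => i Pi; rewrite muleC esumZl// a0.
Qed.

Lemma esum_exchange I J (P : set I) (Q : set J) (a : I -> J -> \bar R) :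
  (forall i j, 0 <= a i j) ->
  \esum_(i in P) \esum_(j in Q) a i j = \esum_(j in Q) \esum_(i in P) a i j.
Proof.
move=> a0; rewrite !esum_esum//.
rewrite (@reindex_esum _ _ _ (Q `*`` (fun=> P)) _ (fun k => (k.2, k.1)))//.
split.
- by move=> [j i] [].
- by move=> [j i] [j' i'] _ _ [-> ->].
- by move=> [i j] [Pi Qj]; exists (j, i).
Qed.

(** The map t |-> t^p has an increasing inverse, so a bound for the powers of all
    finite subsums passes to their supremum. *)
Lemma poweR_esum_le I (D : set I) (p : R) (a : I -> R) (C : \bar R) :
  (0 < p)%R -> (forall i, 0 <= a i)%R -> 0 <= C ->
  (forall s : seq I, uniq s -> (forall i, i \in s -> D i) ->
    ((\sum_(i <- s) a i) `^ p)%:E <= C) ->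
  (\esum_(i in D) (a i)%:E) `^ p <= C.
Proof.
move=> p0 a0 C0 H.
have pN0 : p != 0%R by rewrite gt_eqF.
suff : \esum_(i in D) (a i)%:E <= C `^ p^-1.
  move=> /(poweR_mono (ltW p0)) => /(_ _)/le_trans; apply.
    by rewrite esum_ge0// => i _; rewrite lee_fin.
  by rewrite -poweRrM mulVf// poweRe1.
apply: ge_ereal_sup => _ [X [finX XD] <-].
rewrite fsbig_finite//= sumEFin.
set t := (\sum_(i <- _) _)%R.
have t0 : (0 <= t)%R by rewrite /t sumr_ge0.
have -> : t%:E = (t `^ p)%:E `^ p^-1 by rewrite poweR_EFin -powRrM divff// powRr1.
apply: poweR_mono; first by rewrite invr_ge0 ltW.
  by rewrite lee_fin powR_ge0.
by apply: H => // i; rewrite in_fset_set// inE; exact: XD.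
Qed.

Lemma le_esum_seq I (D : set I) (a : I -> R) (s : seq I) :
  uniq s -> (forall i, i \in s -> D i) ->
  (\sum_(i <- s) a i)%:E <= \esum_(i in D) (a i)%:E.
Proof.
move=> us sD; apply: ereal_sup_ubound; exists [set` s].
  by split; [exact: finite_seq|].
by rewrite -fsbig_seq// sumEFin.
Qed.

End ExtendedSums.

(** * Hoelder and Jensen inequalities *)

Section FiniteInequalities.
Context {R : realType}.

Lemma conjugate_exponent (p : R) : 1 < p ->
  [/\ 0 < p / (p - 1), p^-1 + (p / (p - 1))^-1 = 1 &
     p <= 2 -> p <= p / (p - 1)].
Proof.
move=> p1; have p0 : 0 < p by apply: lt_trans p1.
have p10 : 0 < p - 1 by rewrite subr_gt0.
split; first exact: divr_gt0.
  by rewrite invf_div mulrBl mul1r divff ?gt_eqF// addrC subrK.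
move=> p2; rewrite ler_pdivlMr// ger_pMr// lerBlDr.
by rewrite (le_trans p2)// -natr1.
Qed.

Lemma powR_div_norm (p a x : R) : 0 < p -> 0 < a -> 0 <= x ->
  (x / a `^ p^-1) `^ p = x `^ p / a.
Proof.
move=> p0 a0 x0; have pN0 : p != 0 by rewrite gt_eqF.
apply: (canRL (mulfK _)); first by rewrite gt_eqF.
have {2}-> : a = (a `^ p^-1) `^ p by rewrite -powRrM mulVf// powRr1// ltW.
rewrite -powRM ?powR_ge0//; last by rewrite divr_ge0// powR_ge0.
by rewrite divfK// gt_eqF// powR_gt0.
Qed.

Lemma sum_powR_eq0 (I : eqType) (s : seq I) (p : R) (u : I -> R) :
  \sum_(i <- s) u i `^ p = 0 -> forall i, i \in s -> u i = 0.
Proof.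
move=> /eqP; rewrite psumr_eq0 => [|i _]; last exact: powR_ge0.
by move=> /allP u0 i /u0 /eqP /powR_eq0_eq0.
Qed.

(** Let A and B be the two sums on the right. After division of v by B^(1/p),
    every v i is at most 1, so that the q-th power in Young's inequality is
    bounded by the p-th power, where p <= 2 gives p <= q. *)
Lemma powR_sum_mul_le (I : eqType) (s : seq I) (p : R) (u v : I -> R) :
  1 < p -> p <= 2 -> (forall i, 0 <= u i) -> (forall i, 0 <= v i) ->
  (\sum_(i <- s) u i * v i) `^ p <=
  (\sum_(i <- s) u i `^ p) * (\sum_(i <- s) v i `^ p).
Proof.
move=> p1 p2 u0 v0.
have p0 : 0 < p by apply: lt_trans p1.
have pN0 : p != 0 by rewrite gt_eqF.
have [q0 pq /(_ p2) leqp] := conjugate_exponent p1.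
set q := p / (p - 1) in q0 pq leqp.
set A := \sum_(i <- s) u i `^ p; set B := \sum_(i <- s) v i `^ p.
have A_ge0 : 0 <= A by apply: sumr_ge0 => i _; exact: powR_ge0.
have B_ge0 : 0 <= B by apply: sumr_ge0 => i _; exact: powR_ge0.
have [A0|AN0] := eqVneq A 0.
  rewrite big_seq big1 ?powR0 ?mulr_ge0// => i si.
  by rewrite (sum_powR_eq0 A0 si) mul0r.
have [B0|BN0] := eqVneq B 0.
  rewrite big_seq big1 ?powR0 ?mulr_ge0// => i si.
  by rewrite (sum_powR_eq0 B0 si) mulr0.
have Agt0 : 0 < A by rewrite lt_neqAle eq_sym AN0.
have Bgt0 : 0 < B by rewrite lt_neqAle eq_sym BN0.
have [a aE] : exists a, a = A `^ p^-1 by exists (A `^ p^-1).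
have [b bE] : exists b, b = B `^ p^-1 by exists (B `^ p^-1).
have a0 : 0 < a by rewrite aE powR_gt0.
have b0 : 0 < b by rewrite bE powR_gt0.
suff H : \sum_(i <- s) u i * v i <= a * b.
  have uv0 : 0 <= \sum_(i <- s) u i * v i by apply: sumr_ge0 => i _; rewrite mulr_ge0.
  apply: le_trans (ge0_ler_powR (ltW p0) _ _ H) _; rewrite ?nnegrE//.
    exact: mulr_ge0 (ltW a0) (ltW b0).
  by rewrite powRM ?(ltW a0) ?(ltW b0)// aE bE -!powRrM !mulVf// !powRr1.
have term i : i \in s ->
    u i * v i <= a * b * (u i `^ p / A / p + v i `^ p / B / q).
  move=> si.
  have -> : u i * v i = a * b * ((u i / a) * (v i / b)).
    rewrite mulrACA [a * _]mulrC [b * _]mulrC.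
    by rewrite (divfK (lt0r_neq0 a0)) (divfK (lt0r_neq0 b0)).
  rewrite ler_pM2l ?mulr_gt0//.
  have ua0 : 0 <= u i / a by rewrite divr_ge0// ltW.
  have vb0 : 0 <= v i / b by rewrite divr_ge0// ltW.
  apply: le_trans (conjugate_powR ua0 vb0 p0 q0 pq) _.
  rewrite -(powR_div_norm p0 Agt0)// -(powR_div_norm p0 Bgt0)// -aE -bE.
  rewrite lerD2l.
  rewrite ler_pM2r ?invr_gt0//.
  have [->|vbN0] := eqVneq (v i / b) 0; first by rewrite !powR0// gt_eqF.
  apply: ger_powR => //; rewrite lt_neqAle eq_sym vbN0 vb0/= ler_pdivrMr// mul1r.
  have viB : v i `^ p <= B.
    rewrite /B (big_rem i)//= lerDl; apply: sumr_ge0 => j _; exact: powR_ge0.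
  have -> : v i = (v i `^ p) `^ p^-1 by rewrite -powRrM divff// powRr1.
  by rewrite bE ge0_ler_powR ?nnegrE ?powR_ge0// invr_ge0 ltW.
rewrite big_seq; apply: le_trans (ler_sum _ term) _.
rewrite -big_seq -mulr_sumr big_split/= -!mulr_suml.
by rewrite !divff// !mul1r pq mulr1.
Qed.

(** Jensen's inequality for t |-> t^p with total mass at most 1. With t the
    weighted sum of the h i and S that of their powers, Young's inequality for
    the product of h i and t^(p-1) gives t^p <= S/p + t^p/q, which is
    t^p <= S because 1/p + 1/q = 1. *)
Lemma powR_sum_weighted_le (I : eqType) (s : seq I) (p : R) (c h : I -> R) :
  1 < p -> (forall i, 0 <= c i) -> (forall i, 0 <= h i) ->
  \sum_(i <- s) c i <= 1 ->
  (\sum_(i <- s) c i * h i) `^ p <= \sum_(i <- s) c i * h i `^ p.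
Proof.
move=> p1 c0 h0 c1.
have p0 : 0 < p by apply: lt_trans p1.
have [q0 pq _] := conjugate_exponent p1.
set q := p / (p - 1) in q0 pq.
set t := \sum_(i <- s) c i * h i; set S := \sum_(i <- s) _.
have t0 : 0 <= t by apply: sumr_ge0 => i _; rewrite mulr_ge0.
have tq : (t `^ (p - 1)) `^ q = t `^ p.
  by rewrite -powRrM /q mulrC divfK// gt_eqF// subr_gt0.
have H : t `^ p <= S / p + t `^ p / q.
  rewrite -{1}(mulr_powRB1 t0 p0) /t mulr_suml -/t.
  apply: (@le_trans _ _ (\sum_(i <- s) c i * (h i `^ p / p + t `^ p / q))).
    apply: ler_sum => i _; rewrite -mulrA; apply: ler_wpM2l => //.
    by rewrite -tq; apply: conjugate_powR => //; exact: powR_ge0.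
  under eq_bigr do rewrite mulrDr mulrA.
  rewrite big_split/= -!mulr_suml lerD2l -[leRHS]mul1r.
  by apply: ler_wpM2r => //; rewrite divr_ge0 ?powR_ge0// ltW.
rewrite -(ler_pM2r (_ : 0 < p^-1)) ?invr_gt0//.
have -> : t `^ p / p = t `^ p - t `^ p / q.
  have -> : p^-1 = 1 - q^-1 by rewrite -pq addrK.
  by rewrite mulrBr mulr1.
by rewrite lerBlDr.
Qed.

End FiniteInequalities.

Section ExtendedInequalities.
Context {R : realType} (p : R).
Hypothesis p1 : 1 < p.
Let p0 : 0 < p. Proof. by apply: lt_trans p1. Qed.
Local Open Scope ereal_scope.

Lemma poweR_esum_mul_le (I : choiceType) (D : set I) (u v : I -> R) :
  (p <= 2)%R -> (forall i, 0 <= u i)%R -> (forall i, 0 <= v i)%R ->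
  (\esum_(i in D) (u i * v i)%:E) `^ p <=
  (\esum_(i in D) (u i `^ p)%:E) * (\esum_(i in D) (v i `^ p)%:E).
Proof.
move=> p2 u0 v0.
have s0 (w : I -> R) : 0 <= \esum_(i in D) (w i `^ p)%:E.
  by apply: esum_ge0 => i _; rewrite lee_fin powR_ge0.
apply: poweR_esum_le => //; first by move=> i; rewrite mulr_ge0.
  by rewrite mule_ge0.
move=> s us sD.
apply: le_trans (_ : ((\sum_(i <- s) u i `^ p) * (\sum_(i <- s) v i `^ p))%:E <= _).
  by rewrite lee_fin powR_sum_mul_le.
rewrite EFinM; apply: lee_pmul; rewrite ?lee_fin ?le_esum_seq//.
all: by apply: sumr_ge0 => i _; exact: powR_ge0.
Qed.

Lemma poweR_esum_weighted_le (I : choiceType) (c : I -> R) (h : I -> \bar R) :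
  (forall i, 0 < c i)%R -> (forall i, 0 <= h i) ->
  \esum_(i in [set: I]) (c i)%:E <= 1 ->
  (\esum_(i in [set: I]) ((c i)%:E * h i)) `^ p <=
  \esum_(i in [set: I]) ((c i)%:E * h i `^ p).
Proof.
move=> c0 h0 c1.
(* An infinite h i makes the right-hand side infinite, because c i > 0. *)
have [[i hi]|hfin] := pselect (exists i, h i = +oo).
  apply: le_trans (leey _) _; rewrite (esumID [set i]); last first.
    by move=> j _; rewrite mule_ge0 ?poweR_ge0// lee_fin ltW.
  rewrite setTI esum_set1 ?mule_ge0 ?poweR_ge0 ?lee_fin ?(ltW (c0 i))//.
  rewrite hi poweRyr ?gt_eqF// gt0_muley ?lte_fin// leeDl// esum_ge0// => j _.
  by rewrite mule_ge0 ?poweR_ge0// lee_fin ltW.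
have hE i : h i = (fine (h i))%:E.
  rewrite fineK// ge0_fin_numE// ltey; apply/eqP => hi; apply: hfin; by exists i.
have fh0 i : (0 <= fine (h i))%R by rewrite fine_ge0.
rewrite (@eq_esum _ _ _ _ (fun i => (c i * fine (h i))%:E)); last first.
  by move=> i _; rewrite {1}hE EFinM.
rewrite [leRHS](@eq_esum _ _ _ _ (fun i => (c i * fine (h i) `^ p)%:E)); last first.
  by move=> i _; rewrite {1}hE EFinM.
apply: poweR_esum_le => //.
- by move=> i; rewrite mulr_ge0// ltW.
- by apply: esum_ge0 => i _; rewrite lee_fin mulr_ge0 ?powR_ge0// ltW.
move=> s us sD; apply: le_trans (le_esum_seq _ us sD).
rewrite lee_fin powR_sum_weighted_le// => [i|]; first exact: ltW.
by rewrite -lee_fin; apply: le_trans c1; exact: le_esum_seq.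
Qed.

End ExtendedInequalities.

(** * Convolution over a rectangular class of factorizations *)

Section RectangularConvolution.
Context {R : realType} {F : groupType}.
Local Open Scope ereal_scope.

(** Here b and c are left factors of a: the left factor of one factorization of a
    and the right factor of another one together determine a. Two different
    factorizations are allowed because Hoelder's inequality produces a product
    of two separate sums over the left factors. *)
Definition rectangular (D : F -> set F) := forall a a' b c c',
  D a b -> D a' b -> D a c -> D a' c' -> (c^-1 * a = c'^-1 * a')%g -> a = a'.

(** The bound by a product of two sums decouples the left factor b from the right
    factor c^-1 a. Rectangularity says that (a, b, c) |-> (b, c^-1 a) is
    injective, so that the sum over all triples is at most the product of the two
    full sums. *)
Lemma rectangular_convolution_le (D : F -> set F) (p : R) (u v : F -> R) :
  rectangular D -> (1 < p)%R -> (p <= 2)%R ->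
  (forall a, 0 <= u a)%R -> (forall a, 0 <= v a)%R ->
  \esum_(a in [set: F]) (\esum_(b in D a) (u b * v (b^-1 * a)%g)%:E) `^ p <=
  (\esum_(a in [set: F]) (u a `^ p)%:E) * (\esum_(a in [set: F]) (v a `^ p)%:E).
Proof.
move=> rectD p1 p2 u0 v0.
apply: (@le_trans _ _ (\esum_(a in [set: F]) \esum_(k in D a `*` D a)
    ((u k.1 `^ p)%:E * (v (k.2^-1 * a)%g `^ p)%:E))).
  apply: le_esum => a _; rewrite -(esum_mul (a := fun b => (u b `^ p)%:E)
    (b := fun b => (v (b^-1 * a)%g `^ p)%:E)).
  - exact: poweR_esum_mul_le.
  - by move=> b _; rewrite lee_fin powR_ge0.
  - by move=> b _; rewrite lee_fin powR_ge0.
have pos (b c : F) : 0 <= (u b `^ p)%:E * (v c `^ p)%:E.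
  by rewrite mule_ge0// lee_fin powR_ge0.
rewrite esum_esum// esum_mul.
- apply: (@esum_le_inj _ _ _ _ _ (fun k : F * (F * F) => (k.2.1, (k.2.2^-1 * k.1)%g))
    (fun k => (u k.1 `^ p)%:E * (v k.2 `^ p)%:E)) => //.
  move=> [a [b c]] [a' [b' c']] /set_mem/= [_ [Db Dc]] /set_mem/= [_ [Db' Dc']].
  move=> [ebb' ec]; rewrite -ebb' in Db' *.
  have eaa' := rectD _ _ _ _ _ Db Db' Dc Dc' ec; rewrite -eaa' in ec *.
  by move: ec => /mulIg/invg_inj ->.
- by move=> b _; rewrite lee_fin powR_ge0.
- by move=> b _; rewrite lee_fin powR_ge0.
Qed.

End RectangularConvolution.

(** * Absolutely summable complex families *)

Section ComplexSums.
Context {R : realType} {I : choiceType}.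
Import summability.
#[local] Existing Instance totally_filter.
Implicit Types (z : I -> R[i]) (r : I -> R).

Lemma partial_sumE (z : I -> R[i]^o) (J : {fset I}) :
  partial_sum z J = \sum_(i <- J) z i.
Proof. by rewrite /partial_sum big_seq_fsetE. Qed.

Lemma normc_eq (x : R[i]) : `|x| = (normc x)%:C%C.
Proof. by case: x. Qed.

Lemma normc_ge0 (x : R[i]) : 0 <= normc x.
Proof. by case: x => a b; exact: sqrtr_ge0. Qed.

(** By monotonicity, a finite set whose sum is within eps of the supremum serves
    for all larger finite sets. *)
Lemma partial_sum_cvg_ge0 r : (forall i, 0 <= r i) ->
  (\esum_(i in [set: I]) (r i)%:E < +oo)%E ->
  partial_sum (fun i => (r i)%:C%C : R[i]^o) @ totally -->
    ((fine (\esum_(i in [set: I]) (r i)%:E)%E)%:C%C : R[i]^o).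
Proof.
move=> r0 rfin; set S := (\esum_(_ in _) _)%E in rfin *.
have S0 : (0 <= S)%E by apply: esum_ge0 => i _; rewrite lee_fin.
have SE : (fine S)%:E = S by rewrite fineK// ge0_fin_numE.
apply/cvgrPdist_lt => eps.
case: eps => e e'; rewrite ltcE /= => /andP[/eqP -> e0].
have : (S - e%:E < S)%E by rewrite -SE -EFinB lte_fin ltrBlDr ltrDl.
rewrite {2}/S => /ereal_sup_gt [_ [X [finX _] <-]].
rewrite fsbig_finite//= sumEFin -SE -EFinB lte_fin => XS.
exists (fset_set X) => // J /= XJ.
rewrite partial_sumE -(rmorph_sum (real_complex R))/= -rmorphB/=.
have JS : \sum_(i <- J) r i <= fine S.
  by rewrite -lee_fin SE; apply: le_esum_seq => //; exact: fset_uniq.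
have XJr : \sum_(i <- fset_set X) r i <=
    \sum_(i <- J) r i.
  rewrite -lee_fin.
  have <- : (\esum_(i in [set` J]) (r i)%:E)%E =
      (\sum_(i <- J) r i)%:E.
    rewrite esum_fset//; last by move=> i _; rewrite lee_fin.
    by rewrite -fsbig_seq ?sumEFin// fset_uniq.
  apply: le_esum_seq; first exact: fset_uniq.
  by move=> i iX; exact: (fsubsetP XJ).
rewrite normc_eq ltcR/= expr0n/= addr0 sqrtr_sqr ger0_norm ?subr_ge0//.
by rewrite ltrBlDr -ltrBlDl (lt_le_trans XS).
Qed.

(** The limit that defines the sum exists: split the family into the positive and
    negative parts of its real and imaginary parts. The triangle inequality for
    finite sums then passes to the limit. *)
Lemma normc_sum_le z : (\esum_(i in [set: I]) (normc (z i))%:E < +oo)%E ->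
  ((normc (sum (z : I -> R[i]^o)))%:E <= \esum_(i in [set: I]) (normc (z i))%:E)%E.
Proof.
move=> zfin; set S := (\esum_(_ in _) _)%E in zfin *.
have S0 : (0 <= S)%E by apply: esum_ge0 => i _; rewrite lee_fin normc_ge0.
have SE : (fine S)%:E = S by rewrite fineK// ge0_fin_numE.
have cvg_part (r : I -> R) : (forall i, 0 <= r i) -> (forall i, r i <= normc (z i)) ->
    cvg (partial_sum (fun i => (r i)%:C%C : R[i]^o) @ totally).
  move=> r0 rz; apply/cvg_ex; eexists; apply: partial_sum_cvg_ge0 => //.
  by apply: le_lt_trans zfin; apply: le_esum => i _; rewrite lee_fin.
have re_le i : `|complex.Re (z i)| <= normc (z i).
  case: (z i) => a b /=; rewrite -sqrtr_sqr ler_wsqrtr// lerDl sqr_ge0//.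
have im_le i : `|complex.Im (z i)| <= normc (z i).
  case: (z i) => a b /=; rewrite -sqrtr_sqr ler_wsqrtr// lerDr sqr_ge0//.
(* The positive and negative parts, written so that linear arithmetic applies. *)
pose pos (x : R) := (`|x| + x) / 2; pose neg (x : R) := (`|x| - x) / 2.
have pos0 x : 0 <= pos x.
  by rewrite divr_ge0// -lerBlDr sub0r -normrN ler_norm.
have neg0 x : 0 <= neg x by rewrite divr_ge0// subr_ge0 ler_norm.
have posneg x : x = pos x - neg x.
  by rewrite /pos /neg; lra.
have pos_le x : pos x <= `|x| by have := ler_norm x; rewrite /pos; lra.
have neg_le x : neg x <= `|x|.
  by have := ler_norm (- x); rewrite normrN /neg; lra.
have cz : cvg (partial_sum (z : I -> R[i]^o) @ totally).
  pose P r := partial_sum (fun i => (r i)%:C%C : R[i]^o).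
  have -> : partial_sum (z : I -> R[i]^o) =
      (P (pos \o (fun i => complex.Re (z i))) - P (neg \o (fun i => complex.Re (z i)))) +
      ('i%C : R[i]) *: (P (pos \o (fun i => complex.Im (z i))) - P (neg \o (fun i => complex.Im (z i)))).
    apply/funext => J.
    rewrite !fctE /P !partial_sumE -!sumrB scaler_sumr -big_split/=.
    apply: eq_bigr => i _; rewrite -!rmorphB/= -!posneg.
    exact: complexE.
  have cvg_pn (part : R[i] -> R) : (forall i, `|part (z i)| <= normc (z i)) ->
      cvg (P (pos \o (fun i => part (z i))) - P (neg \o (fun i => part (z i))) @ totally).
    move=> part_le; apply: is_cvgB; apply: cvg_part => i /=.
    - exact: pos0.
    - exact: le_trans (pos_le _) (part_le i).
    - exact: neg0.
    - exact: le_trans (neg_le _) (part_le i).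
  by apply: is_cvgD; last apply: is_cvgZr; exact: cvg_pn.
set l := sum _; have zl : partial_sum (z : I -> R[i]^o) @ totally --> (l : R[i]^o) by [].
rewrite -SE lee_fin; apply/ler_addgt0Pr => e e0.
have /cvgrPdist_lt/(_ e%:C%C) := zl.
rewrite ltcR => /(_ e0)[J _ /(_ J)/= ]; rewrite fsubset_refl => /(_ isT).
rewrite normc_eq ltcR => lJ.
have nJ : normc (partial_sum (z : I -> R[i]^o) J) <= fine S.
  rewrite partial_sumE.
  apply: (@le_trans _ _ (\sum_(i <- J) normc (z i))).
    rewrite -lecR -normc_eq rmorph_sum/=.
    under [leRHS]eq_bigr do rewrite -normc_eq.
    exact: ler_norm_sum.
  by rewrite -lee_fin SE; apply: le_esum_seq => //; exact: fset_uniq.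
rewrite -[l](subrK (partial_sum (z : I -> R[i]^o) J)).
apply: le_trans (le_normcD _ _) _.
by rewrite addrC lerD// ltW.
Qed.

End ComplexSums.

(** * Weights adapted to a cover by rectangular classes *)

Section Cover.
Context {R : realType} {F : groupType}.

Lemma normcZr (z : R[i]) (r : R) : 0 <= r -> normc (z * r%:C%C) = normc z * r.
Proof.
by move=> r0; rewrite normcM {2}/normc/= expr0n/= addr0 sqrtr_sqr ger0_norm.
Qed.

(** The factor c i bounds the loss of submultiplicativity of w on the class D i.
    Hence the weighted convolution of |f| and |g| is at most the c-weighted sum,
    over the classes, of contractive restricted convolutions of |f| w and |g| w;
    Jensen's inequality bounds its p-th power. *)
Theorem Lp_banach_algebra_of_cover (I : choiceType) (D : I -> F -> set F)
    (c : I -> R) (w : F -> R) :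
  (forall a, 0 < w a) -> (forall i, rectangular (D i)) ->
  (forall i, 0 < c i) -> (\esum_(i in [set: I]) (c i)%:E <= 1)%E ->
  (forall a b, exists2 i, D i a b & w a <= c i * (w b * w (b^-1 * a)%g)) ->
  forall p : R, 1 < p -> p <= 2 -> Lp_banach_algebra p w.
Proof.
move=> w0 rectD c0 c1 cover p p1 p2 f g fLp gLp.
have p0 : 0 < p by apply: lt_trans p1.
pose u x := normc (f x) * w x; pose v x := normc (g x) * w x.
have u0 x : 0 <= u x by rewrite mulr_ge0 ?normc_ge0// ltW.
have v0 x : 0 <= v x by rewrite mulr_ge0 ?normc_ge0// ltW.
have wsumE h : wsum p w h =
    (\esum_(x in [set: F]) ((normc (h x) * w x) `^ p)%:E)%E.
  by apply: eq_esum => x _; rewrite normcZr// ltW.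
have wsum0 h : (0 <= wsum p w h)%E.
  by apply: esum_ge0 => x _; rewrite lee_fin powR_ge0.
pose N a := (\esum_(b in [set: F]) (normc (convolution_term f g a b))%:E)%E.
have N0 a : (0 <= N a)%E by apply: esum_ge0 => b _; rewrite lee_fin normc_ge0.
pose E i a := (\esum_(b in D i a) (u b * v (b^-1 * a)%g)%:E)%E.
have uv0 a b : (0 <= (u b * v (b^-1 * a)%g)%:E)%E by rewrite lee_fin mulr_ge0.
have E0 i a : (0 <= E i a)%E by exact: esum_ge0.
have NE a : ((w a)%:E * N a <= \esum_(i in [set: I]) ((c i)%:E * E i a))%E.
  (* Every b is counted on the right in at least one class, with a factor c i
     that compensates for the ratio of the weights. *)
  have t0 i b : (0 <= (c i)%:E *
      (if b \in D i a then (u b * v (b^-1 * a)%g)%:E else 0))%E.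
    by rewrite mule_ge0 ?lee_fin ?(ltW (c0 i))//; case: ifP.
  rewrite -esumZl ?lee_fin ?(ltW (w0 a))//; last first.
    by move=> b _; rewrite lee_fin normc_ge0.
  apply: (@le_trans _ _ (\esum_(b in [set: F]) \esum_(i in [set: I])
      ((c i)%:E * (if b \in D i a then (u b * v (b^-1 * a)%g)%:E else 0)))%E).
    apply: le_esum => b _; have [i Dib wi] := cover a b.
    rewrite (esumID [set i])// setTI esum_set1// mem_set//.
    apply: le_trans (leeDl _ _); last exact: esum_ge0.
    rewrite -!EFinM lee_fin /convolution_term normcM /u /v mulrACA.
    rewrite [leLHS]mulrC [leRHS]mulrCA; apply: ler_wpM2l => //.
    by rewrite mulr_ge0 ?normc_ge0.
  rewrite esum_exchange//; apply: le_esum => i _.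
  rewrite esumZl ?lee_fin ?(ltW (c0 i))//; last by move=> b _; case: ifP.
  by rewrite -esum_mkcond.
have total : (\esum_(a in [set: F]) ((w a)%:E * N a) `^ p <=
    wsum p w f * wsum p w g)%E.
  have Ep0 i a : (0 <= (c i)%:E * E i a `^ p)%E.
    by rewrite mule_ge0 ?poweR_ge0// lee_fin ltW.
  apply: (@le_trans _ _ (\esum_(a in [set: F]) \esum_(i in [set: I])
      ((c i)%:E * E i a `^ p))%E).
    apply: le_esum => a _; apply: le_trans (poweR_esum_weighted_le p1 c0 _ c1) => //.
    apply: poweR_mono (NE a); first exact: ltW.
    by rewrite mule_ge0// lee_fin ltW.
  rewrite esum_exchange//.
  apply: (@le_trans _ _ (\esum_(i in [set: I])
      (wsum p w f * wsum p w g * (c i)%:E))%E).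
    apply: le_esum => i _; rewrite esumZl ?lee_fin ?(ltW (c0 i))//; last first.
      by move=> a _; exact: poweR_ge0.
    rewrite muleC; apply: lee_wpmul2r; first by rewrite lee_fin ltW.
    by rewrite !wsumE; exact: rectangular_convolution_le.
  rewrite esumZl ?mule_ge0// => [|i _]; last by rewrite lee_fin ltW.
  by rewrite -[leRHS]mule1; apply: lee_wpmul2l => //; rewrite mule_ge0.
have fin_total : (wsum p w f * wsum p w g < +oo)%E.
  by apply: lte_mul_pinfty => //; rewrite ge0_fin_numE.
have Nfin a : (N a < +oo)%E.
  have : (((w a)%:E * N a) `^ p < +oo)%E.
    apply: le_lt_trans (le_lt_trans total fin_total).
    rewrite (esumID [set a]) => [|b _]; last exact: poweR_ge0.
    rewrite setTI esum_set1 ?poweR_ge0// leeDl// esum_ge0// => b _.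
    exact: poweR_ge0.
  move=> /lty_poweRy; rewrite gt_eqF// => /(_ isT).
  rewrite !ltey; apply: contra => /eqP ->.
  by rewrite gt0_muley// lte_fin.
have conv_le : (wsum p w (convolution f g) <= wsum p w f * wsum p w g)%E.
  apply: le_trans total; rewrite wsumE; apply: le_esum => a _.
  rewrite -poweR_EFin; apply: poweR_mono; first exact: ltW.
    by rewrite lee_fin mulr_ge0 ?normc_ge0// ltW.
  rewrite EFinM muleC; apply: lee_wpmul2l; first by rewrite lee_fin ltW.
  by apply: normc_sum_le; exact: Nfin.
split.
- move=> a; rewrite /summable; apply: le_lt_trans (Nfin a).
  by apply: le_esum => b _; rewrite abse_EFin ger0_norm ?normc_ge0.
- exact: le_lt_trans conv_le fin_total.
- rewrite /wnorm -poweRM//; apply: poweR_mono => //.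
  by rewrite invr_ge0 ltW.
Qed.

End Cover.

(** * The polynomial length weight *)

Section LengthWeight.
Context {R : realType}.

(** The terms of the telescoping series of 1/(n+1) - 1/(n+2), with sum 1. *)
Definition inv_pronic (n : nat) : R := (n.+1%:R * n.+2%:R)^-1.

Lemma inv_pronic_gt0 n : 0 < inv_pronic n.
Proof. by rewrite invr_gt0 mulr_gt0 ?ltr0n. Qed.

Lemma esum_inv_pronic : (\esum_(n in [set: nat]) (inv_pronic n)%:E <= 1)%E.
Proof.
have d0 n : (0 <= (inv_pronic n)%:E)%E by rewrite lee_fin ltW// inv_pronic_gt0.
rewrite -nneseries_esumT//; apply: lime_le; first exact: is_cvg_nneseries.
apply: nearW => N; rewrite sumEFin lee_fin.
have -> : \sum_(0 <= n < N) inv_pronic n = 1 - N.+1%:R^-1.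
  elim: N => [|N IH]; first by rewrite big_nil invr1 subrr.
  rewrite big_nat_recr//= IH /inv_pronic -[N.+2%:R]natr1.
  have : 0 < N.+1%:R :> R by rewrite ltr0n.
  move: (N.+1%:R : R) => x x0; field.
  by rewrite !gt_eqF// addr_gt0.
by rewrite gerBl invr_ge0.
Qed.

(** The index (s, (n, j)) describes a product of reduced words: j is the length of
    the cancelled part, n the length of one of the two remaining parts, and s
    says which one. The factor 1/2 accounts for the two values of s. *)
Definition overlap_weight (i : bool * (nat * nat)) : R :=
  2^-1 * (inv_pronic i.2.1 * inv_pronic i.2.2).

Lemma overlap_weight_gt0 i : 0 < overlap_weight i.
Proof. by rewrite !mulr_gt0 ?inv_pronic_gt0// invr_gt0. Qed.

Lemma esum_overlap_weight :
  (\esum_(i in [set: bool * (nat * nat)]) (overlap_weight i)%:E <= 1)%E.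
Proof.
have d0 n : (0 <= (inv_pronic n)%:E)%E by rewrite lee_fin ltW// inv_pronic_gt0.
rewrite -setXTT (@eq_esum _ _ _ _ (fun i => 2^-1%:E *
    ((inv_pronic i.2.1)%:E * (inv_pronic i.2.2)%:E))%E); last by move=> *; rewrite -!EFinM.
rewrite -(esum_mul (a := fun=> 2^-1%:E)
  (b := fun k => ((inv_pronic k.1)%:E * (inv_pronic k.2)%:E)%E)); last 2 first.
- by move=> _ _; rewrite lee_fin invr_ge0.
- by move=> k _; rewrite mule_ge0.
have -> : (\esum_(s in [set: bool]) 2^-1%:E = 1 :> \bar R)%E.
  rewrite (esumID [set true]) => [|b _]; last by rewrite lee_fin invr_ge0.
  have -> : [set: bool] `&` ~` [set true] = [set false].
    by apply/seteqP; split => [[]|[]]//= [].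
  rewrite setTI !esum_set1 ?lee_fin ?invr_ge0// -EFinD; congr _%:E; lra.
rewrite mul1e -setXTT -(esum_mul (a := fun n => (inv_pronic n)%:E)
  (b := fun n => (inv_pronic n)%:E))//.
by rewrite -[leRHS]mule1; apply: lee_pmul; rewrite ?esum_inv_pronic// esum_ge0.
Qed.

(** The exponent 4 provides two powers of n + 1 and two of j + 1 in the index
    (n, j) of a class; the factor 128 = 2 * 4 * 16 is made of the 1/2 in
    [overlap_weight], of (n+2)(j+2) <= 4 (n+1)(j+1), and of the fourth power of
    x + y + 1 <= 2 (j + y + 1). *)
Definition length_weight (n : nat) : R := 128 * n.+1%:R ^+ 4.

Lemma length_weight_gt0 n : 0 < length_weight n.
Proof. by rewrite mulr_gt0// exprn_gt0// ltr0n. Qed.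

Lemma length_weight_mul_nat x y j : (x <= y)%N ->
  (2 * (x.+1 * x.+2 * (j.+1 * j.+2)) * (x + y).+1 ^ 4 <=
   128 * ((x + j).+1 ^ 4 * (j + y).+1 ^ 4))%N.
Proof.
move=> xy.
have h1 : (x.+1 * x.+2 * (j.+1 * j.+2) <= 4 * (x + j).+1 ^ 4)%N.
  have h2 : (x.+1 * x.+2 <= 2 * (x + j).+1 ^ 2)%N.
    rewrite mulnCA leq_mul//; lia.
  have h3 : (x.+1 * j.+1 <= (x + j).+1 ^ 2)%N by rewrite leq_mul//; lia.
  have h4 : (x.+2 * j.+2 <= 4 * (x.+1 * j.+1))%N.
    by rewrite (_ : 4 = 2 * 2)%N// mulnACA leq_mul//; lia.
  rewrite mulnACA (_ : 4 = 2 + 2)%N// expnD.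
  apply: leq_trans (leq_mul h3 h4) _.
  by rewrite mulnCA leq_mul// leq_mul.
have h5 : ((x + y).+1 ^ 4 <= 16 * (j + y).+1 ^ 4)%N.
  by rewrite (_ : 16 = 2 ^ 4)%N// -expnMn leq_exp2r//; lia.
rewrite -mulnA; apply: leq_trans (leq_mul (leqnn 2) (leq_mul h1 h5)) _.
by rewrite mulnACA mulnA.
Qed.

Lemma length_weight_mul (x y j : nat) : (x <= y)%N ->
  length_weight (x + y) <= 2^-1 * (inv_pronic x * inv_pronic j) *
    (length_weight (x + j) * length_weight (j + y)).
Proof.
move=> xy; rewrite /inv_pronic -!invfM [leRHS]mulrC ler_pdivlMr; last first.
  by rewrite !mulr_gt0 ?ltr0n.
have := length_weight_mul_nat j xy.
rewrite -(ler_nat R) 7!natrM !natrX /length_weight.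
move: (_ * (_ * _)) (_ ^+ 4) (_ ^+ 4) (_ ^+ 4) => P r s t H.
by lra.
Qed.

End LengthWeight.

(** * Factorizations in a free group, sorted by overlap *)

Section Overlaps.
Variables (F : groupType) (X : set F) (nf : F -> seq (X * bool)).
Hypothesis nf_reduced : forall a, reduced (nf a).
Hypothesis nfK : cancel nf (@word_val F X).
Hypothesis word_valK : forall s : seq (X * bool), reduced s -> nf (word_val s) = s.

(** Fixing the length of x or that of y makes the splitting point of the word of a
    depend on a alone. *)
Definition overlap (i : bool * (nat * nat)) (a b : F) : Prop :=
  exists x e y, [/\ nf a = x ++ y, nf b = x ++ e,
    nf (b^-1 * a)%g = word_inv e ++ y,
    size (if i.1 then x else y) = i.2.1 & size e = i.2.2].

Lemma cat_inj_size_r (T : eqType) (s s' t t' : seq T) :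
  size t = size t' -> s ++ t = s' ++ t' -> s = s' /\ t = t'.
Proof.
move=> stt' st; have sss' : size s = size s'.
  by move/(congr1 size): st; rewrite !size_cat stt' => /addIn.
by move/eqP: st; rewrite eqseq_cat// => /andP[/eqP -> /eqP ->].
Qed.

Lemma cat_inj_size_l (T : eqType) (s s' t t' : seq T) :
  size s = size s' -> s ++ t = s' ++ t' -> s = s' /\ t = t'.
Proof.
by move=> ss /eqP; rewrite eqseq_cat// => /andP[/eqP -> /eqP ->].
Qed.

(** All factorizations of a in one class split the word of a at the same point. The
    word of b ends in exactly j cancelled letters, so it determines x; likewise
    the word of the right factor determines y. *)
Lemma overlap_rectangular i : rectangular (overlap i).
Proof.
have split_uniq a x y x' y' : nf a = x ++ y -> nf a = x' ++ y' ->
    size (if i.1 then x else y) = i.2.1 ->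
    size (if i.1 then x' else y') = i.2.1 -> x = x' /\ y = y'.
  move=> -> E; case: i.1 => s s'.
    by apply: cat_inj_size_l E; rewrite s s'.
  by apply: cat_inj_size_r E; rewrite s s'.
move=> a a' b c c' [x1 [e1 [y1 [a1 b1 _ n1 j1]]]] [x2 [e2 [y2 [a2 b2 _ n2 j2]]]].
move=> [x3 [e3 [y3 [a3 _ c3 n3 j3]]]] [x4 [e4 [y4 [a4 _ c4 n4 j4]]]] cc'.
have [x13 y13] := split_uniq _ _ _ _ _ a1 a3 n1 n3.
have [x24 y24] := split_uniq _ _ _ _ _ a2 a4 n2 n4.
have [x12 _] : x1 = x2 /\ e1 = e2.
  by apply: cat_inj_size_r; rewrite ?j1 ?j2// -b1 -b2.
have [_ y34] : word_inv e3 = word_inv e4 /\ y3 = y4.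
  by apply: cat_inj_size_l; rewrite ?size_word_inv ?j3 ?j4// -c3 -c4 cc'.
by apply: (can_inj nfK); rewrite a1 a2 x12 y13 y34 y24.
Qed.

(** The class is chosen by the shorter of x and y, because the longer of the two
    factors of a absorbs the growth of w. *)
Lemma overlap_cover (R : realType) (a b : F) : exists2 i, overlap i a b &
  @length_weight R (size (nf a)) <= overlap_weight i *
    (length_weight (size (nf b)) * length_weight (size (nf (b^-1 * a)%g))).
Proof.
have [x [e [y [be ce rxy]]]] :=
  reduced_cancellation (nf_reduced b) (nf_reduced (b^-1 * a)%g).
have ae : nf a = x ++ y.
  rewrite -(word_valK rxy) -(mulVKg b a) -{1}(nfK b) -(nfK (b^-1 * a)%g) be ce.
  by rewrite !word_val_cat word_val_inv -mulgA mulVKg.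
have [xy|/ltnW yx] := leqP (size x) (size y).
  exists (true, (size x, size e)); first by exists x, e, y.
  by rewrite ae be ce !size_cat size_word_inv; exact: length_weight_mul.
exists (false, (size y, size e)); first by exists x, e, y.
rewrite ae be ce !size_cat size_word_inv addnC [(size x + size e)%N]addnC.
rewrite [(size e + size y)%N]addnC [length_weight (size e + _)%N * _]mulrC.
exact: length_weight_mul.
Qed.

End Overlaps.

Theorem theorem1p1 (R : realType) (F : groupType)
    (F_free : free_group F) (F_infinite : infinite_set [set: F]) :
  exists w : F -> R,
    (forall x, 0 < w x) /\
    (forall p : R, 1 < p -> p <= 2 -> Lp_banach_algebra p w).
Proof.
have [X freeX] := F_free.
have [nf [nf_reduced nfK word_valK]] := free_basis_normal_form freeX.
have w0 a : 0 < length_weight (size (nf a)) :> R by exact: length_weight_gt0.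
exists (fun a => length_weight (size (nf a))); split => //.
apply: (Lp_banach_algebra_of_cover (D := overlap nf) (c := overlap_weight)) => //.
- exact: overlap_rectangular.
- exact: overlap_weight_gt0.
- exact: esum_overlap_weight.
- exact: overlap_cover.
Qed.
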